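(* Assume that Variant A.3 of the algorithm described in the context does not stop, and let $\{x^k\}_{k\in\mathbb{N}}$ be the sequence it generates. Define $\bar x=P_{S^*\cap X}(x^0)$. Then $\{x^k\}_{k\in\mathbb{N}}$ converges to $\bar x$.
   Context: Setting. $\mathbb{R}^n$ carries its inner product $\langle\cdot,\cdot\rangle$ and norm $\|\cdot\|$; $P_C$ is the orthogonal projection onto a nonempty closed convex set $C$; $B[c,r]$ is the closed ball with center $c$ and radius $r$. Let $\mathbb{I}=\{1,\dots,m\}$, $m\in\mathbb{N}$. For $i\in\mathbb{I}$, $A_i:\mathbb{R}^n\to\mathbb{R}^n$ is point-to-point and maximal monotone, $B_i:\mathbb{R}^n\to2^{\mathbb{R}^n}$ is point-to-set and maximal monotone, $\mathrm{dom}(B_i)\subseteq\mathrm{dom}(A_i)$. Let $S_i^*=\{x: 0\in A_i(x)+B_i(x)\}$, $S^*=\bigcap_{i\in\mathbb{I}}S_i^*$. $X\subseteq\bigcap_{i\in\mathbb{I}}\mathrm{dom}(B_i)$ is a nonempty closed convex set with $X\cap S^*\neq\emptyset$. Assumption on $B_i$: for each bounded subset $V$ of $\mathrm{dom}(B_i)$ there exists $R>0$ such that $B_i(x)\cap B[0,R]\ne\emptyset$ for all $x\in V$, $i\in\mathbb{I}$. Parameters: $\{\beta_k\}_{k\in\mathbb{N}}\subseteq[\check\beta,\hat\beta]$ with $0<\check\beta\le\hat\beta<\infty$; $\theta,\delta\in(0,1)$; $R>0$ is a constant provided by this assumption for a bounded set containing the points at which elements of $B_i$ are selected in Step 3, so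 that those selections are possible. Algorithm (Variant A.3). Step 0: take $x^0\in X$. Step 1: given $x^k$, compute $J_i(x^k,\beta_k):=(I+\beta_kB_i)^{-1}(I-\beta_kA_i)(x^k)$ for all $i\in\mathbb{I}$. Step 2: let $\mathbb{I}_k^*:=\{i\in\mathbb{I}: x^k=J_i(x^k,\beta_k)\}$; if $\mathbb{I}_k^*=\mathbb{I}$, stop. Step 3 (inner loop): otherwise, for each $i\in\mathbb{I}\setminus\mathbb{I}_k^*$ and successively $j=0,1,2,\dots$, choose any $u^k_{(j,i)}\in B_i\big(\theta^jJ_i(x^k,\beta_k)+(1-\theta^j)x^k\big)\cap B[0,R]$; at the first $j$ for which $\big\langle A_i(\theta^jJ_i(x^k,\beta_k)+(1-\theta^j)x^k)+u^k_{(j,i)},x^k-J_i(x^k,\beta_k)\big\rangle\ge\frac{\delta}{\beta_k}\|x^k-J_i(x^k,\beta_k)\|^2$, set $j_i(k):=j$ and stop the inner loop. Step 4: for $i\in\mathbb{I}\setminus\mathbb{I}_k^*$ set $\alpha_{k,i}:=\theta^{j_i(k)}$, $\bar u_i^k:=u^k_{(j_i(k),i)}$, $\bar x_i^k:=\alpha_{k,i}J_i(x^k,\beta_k)+(1-\alpha_{k,i})x^k$, and set $x^{k+1}:=P_{X\cap H_k\cap W_k}(x^0)$, where $H_i(x,u)=\{y\in\mathbb{R}^n:\langle A_i(x)+u,y-x\rangle\le0\}$, $H_k=\bigcap_{i\in\mathbb{I}\setminus\mathbb{I}_k^*}H_i(\bar x_i^k,\bar u_i^k)$ and $W_k=W(x^k)=\{y\in\mathbb{R}^n:\langle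 y-x^k,x^0-x^k\rangle\le0\}$. Step 5: if $x^{k+1}=x^k$, stop; otherwise replace $k$ by $k+1$ and go to Step 1. *)

(* Defs.v *)
From HB Require Import structures.
From mathcomp Require Import all_boot all_order all_algebra.
From mathcomp Require Import all_classical all_reals all_analysis.

Set Implicit Arguments.
Unset Strict Implicit.
Unset Printing Implicit Defensive.

Import Order.TTheory GRing.Theory Num.Theory.
Import numFieldNormedType.Exports.

Local Open Scope classical_set_scope.
Local Open Scope ring_scope.

(** * Euclidean structure on 'rV[R]_n

    The library norm [`|x|] on ['rV[R]_n] is the sup norm.  It induces the
    usual topology and the usual bounded sets, so [closed], [bounded_set] and
    [-->] are taken from the library, whereas every metric notion (inner
    product, balls, projections) uses the Euclidean norm below. *)

Section Euclidean.
Context {R : realType} {n : nat}.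
Implicit Types (x y c : 'rV[R]_n) (C : set 'rV[R]_n).

Definition dot x y : R := \sum_(l < n) x 0 l * y 0 l.

Definition enorm x : R := Num.sqrt (dot x x).

Definition eball c (r : R) : set 'rV[R]_n := [set x | enorm (x - c) <= r].

(* The default value [x] is used only when [C] has no point nearest to [x],
   hence never when [C] is nonempty, closed and convex. *)
Definition eproj C x : 'rV[R]_n :=
  xget x [set p | C p /\ forall y, C y -> enorm (x - p) <= enorm (x - y)].

End Euclidean.

(** * Point-to-set operators *)

Definition operator (R : realType) (n : nat) : Type :=
  'rV[R]_n -> set 'rV[R]_n.

Section Operators.
Context {R : realType} {n : nat}.
Implicit Types (S T : operator R n) (x : 'rV[R]_n).

Definition dom T : set 'rV[R]_n := [set x | T x !=set0].

(* A point-to-point operator, given by its domain [D] and its values [f] on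
   [D]; the values of [f] outside [D] are irrelevant. *)
Definition ptop (D : set 'rV[R]_n) (f : 'rV[R]_n -> 'rV[R]_n) : operator R n :=
  fun x => [set v | D x /\ v = f x].

Definition op_id : operator R n := fun x => [set x].
Definition op_add S T : operator R n :=
  fun x => [set s + t | s in S x & t in T x].
Definition op_scale (a : R) T : operator R n := fun x => [set a *: t | t in T x].
Definition op_inv T : operator R n := fun y => [set x | T x y].

Definition zeros T : set 'rV[R]_n := [set x | T x 0].

Definition monotone_op T : Prop :=
  forall x y u v, T x u -> T y v -> 0 <= dot (u - v) (x - y).

Definition maximal_monotone T : Prop :=
  monotone_op T /\
  forall T', monotone_op T' -> (forall x, T x `<=` T' x) ->
    forall x, T' x `<=` T x.

Definition resolvent (b : R) T : operator R n :=
  op_inv (op_add op_id (op_scale b T)).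

End Operators.

Section Problem.
Context {R : realType} {n m : nat}.
Variables (domA : 'I_m -> set 'rV[R]_n) (A : 'I_m -> 'rV[R]_n -> 'rV[R]_n).
Variable B : 'I_m -> operator R n.

Definition Sstar : set 'rV[R]_n :=
  \bigcap_(i : 'I_m) zeros (op_add (ptop (domA i) (A i)) (B i)).

Definition bounded_in_doms (V : 'I_m -> set 'rV[R]_n) : Prop :=
  forall i, bounded_set (V i) /\ V i `<=` dom (B i).

Definition selection_radius (V : 'I_m -> set 'rV[R]_n) (r : R) : Prop :=
  0 < r /\ forall i x, V i x -> B i x `&` eball 0 r !=set0.

Definition bounded_selection_assumption : Prop :=
  forall V, bounded_in_doms V -> exists r, selection_radius V r.

Definition Hplane (i : 'I_m) (x u : 'rV[R]_n) : set 'rV[R]_n :=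
  [set y | dot (A i x + u) (y - x) <= 0].

Definition Wplane (x0 x : 'rV[R]_n) : set 'rV[R]_n :=
  [set y | dot (y - x) (x0 - x) <= 0].

Section Run.
Variables (X : set 'rV[R]_n) (beta : nat -> R) (theta delta r : R).

(* Data of a run: the iterates [xs k], the points [J k i] standing for
   J_i(x^k, beta_k), the selections [u k j i] made in the inner loop, and the
   index [ls k i] at which the inner loop for [i] terminates.  [u k j i] is
   meaningful only for [j <= ls k i], and [u], [ls] only for [i] outside
   [fixed_indices k]. *)
Variables (xs : nat -> 'rV[R]_n) (J : nat -> 'I_m -> 'rV[R]_n).
Variables (u : nat -> nat -> 'I_m -> 'rV[R]_n) (ls : nat -> 'I_m -> nat).

Definition fixed_indices (k : nat) : set 'I_m := [set i | xs k = J k i].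

Definition trial (k j : nat) (i : 'I_m) : 'rV[R]_n :=
  theta ^+ j *: J k i + (1 - theta ^+ j) *: xs k.

Definition linesearch_test (k j : nat) (i : 'I_m) : Prop :=
  delta / beta k * enorm (xs k - J k i) ^+ 2
    <= dot (A i (trial k j i) + u k j i) (xs k - J k i).

Definition xbar k i := trial k (ls k i) i.
Definition ubar k i := u k (ls k i) i.

Definition Hk (k : nat) : set 'rV[R]_n :=
  \bigcap_(i in ~` fixed_indices k) Hplane i (xbar k i) (ubar k i).

Definition Wk (k : nat) : set 'rV[R]_n := Wplane (xs 0%N) (xs k).

Record variantA3_run : Prop := VariantA3Run {
  run_init : X (xs 0%N);
  (* By monotonicity of [B i] the resolvent has at most one value, so this
     membership determines [J k i]. *)
  run_resolvent : forall k i,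
    resolvent (beta k) (B i) (xs k - beta k *: A i (xs k)) (J k i);
  run_select : forall k i j, ~ fixed_indices k i -> (j <= ls k i)%N ->
    (B i (trial k j i) `&` eball 0 r) (u k j i);
  run_reject : forall k i j, ~ fixed_indices k i -> (j < ls k i)%N ->
    ~ linesearch_test k j i;
  run_accept : forall k i, ~ fixed_indices k i ->
    linesearch_test k (ls k i) i;
  run_update : forall k, xs k.+1 = eproj (X `&` Hk k `&` Wk k) (xs 0%N)
}.

Definition never_stops : Prop :=
  forall k, fixed_indices k <> setT /\ xs k.+1 <> xs k.

Definition radius_provided : Prop :=
  exists V, [/\ bounded_in_doms V, selection_radius V r &
    forall k i j, ~ fixed_indices k i -> (j <= ls k i)%N -> V i (trial k j i)].

End Run.
End Problem.

(* Main.v *)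
Require Import Defs.
From HB Require Import structures.
From mathcomp Require Import all_boot all_order all_algebra.
From mathcomp Require Import all_classical all_reals all_analysis.
From mathcomp Require Import ring lra.
Set Implicit Arguments.
Unset Strict Implicit.
Unset Printing Implicit Defensive.
Import Order.TTheory GRing.Theory Num.Theory.
Import numFieldNormedType.Exports.
Local Open Scope classical_set_scope.
Local Open Scope ring_scope.

(** Why the theorem holds.  Every solution [p] in [X] lies in each of the sets
    [X `&` H_k `&` W_k]: in [H_k] by monotonicity of [A_i] and [B_i], and in
    [W_k] because [x^k] is the projection of [x^0] onto the previous set
    ([solution_C]).  Since [x^k] is the point of [W_k] nearest to [x^0],
    Pythagoras' inequality makes the distances from [x^0] to [x^k] increase,
    bounded by the distance from [x^0] to [p].  Hence the sequence is bounded
    and its steps vanish ([xs_step_cvg0]).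

    Let [x] be a cluster point and [j] the corresponding limit of the points
    [J_i(x^k, beta_k)].  The point [x^(k+1)] lies in [H_k], so the line search
    inequality bounds [alpha_k |x^k - J_i|^2] by the product of a bounded
    factor with the vanishing step.  If [alpha_k] stays away from [0] this
    forces [x = j].  If [alpha_k] tends to [0], the last rejected trial points
    converge to [x], and the limit of their failed tests contradicts the
    monotonicity of [B_i] unless [x = j] ([forward_backward_unique]).  Closedness
    of the graph of [B_i] turns [x = j] into [0 \in A_i(x) + B_i(x)]
    ([cluster_zero]).

    So [x] belongs to [S^*] and to [X].  Passing to the limit in [p \in W_k],
    every [p] in [S^*] and [X] satisfies [<p - x, x^0 - x> <= 0], which
    identifies [x] as the unique nearest point ([eproj_unique]).  All cluster
    points thus agree.

    Two tools shorten the argument.  Subsequences are replaced by ultrafilters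
    finer than [\oo]: every bounded sequence converges along an ultrafilter,
    which therefore serves all the auxiliary sequences at once, and convergence
    along all of them is convergence ([cvg_ultra]).  The continuity of the
    single-valued maximal monotone [A_i] on its domain is read off
    the monotonicity inequalities alone ([ptop_continuous]). *)

(** * Inner product *)

Section Dot.
Context {R : realType} {n : nat}.
Implicit Types x y z : 'rV[R]_n.

Lemma dotC x y : dot x y = dot y x.
Proof. by apply: eq_bigr => l _; rewrite mulrC. Qed.

Lemma dotDl x y z : dot (x + y) z = dot x z + dot y z.
Proof. by rewrite -big_split; apply: eq_bigr => l _; rewrite mxE mulrDl. Qed.

Lemma dotZl (a : R) x z : dot (a *: x) z = a * dot x z.
Proof. by rewrite [RHS]mulr_sumr; apply: eq_bigr => l _; rewrite mxE mulrA. Qed.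

Lemma dotNl x z : dot (- x) z = - dot x z.
Proof. by rewrite -scaleN1r dotZl mulN1r. Qed.

Lemma dotDr x y z : dot x (y + z) = dot x y + dot x z.
Proof. by rewrite dotC dotDl !(dotC x). Qed.

Lemma dotZr (a : R) x z : dot x (a *: z) = a * dot x z.
Proof. by rewrite dotC dotZl dotC. Qed.

Lemma dotNr x z : dot x (- z) = - dot x z.
Proof. by rewrite dotC dotNl dotC. Qed.

Definition dotE := (dotDl, dotDr, dotNl, dotNr, dotZl, dotZr).

Lemma dotB_sqr x y : dot (x - y) (x - y) = dot x x - 2 * dot y x + dot y y.
Proof. by rewrite !dotE (dotC x y); ring. Qed.

Lemma dot0r x : dot x 0 = 0.
Proof. by rewrite -(scale0r x) dotZr mul0r. Qed.

Lemma dotxx_ge0 x : 0 <= dot x x.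
Proof. by apply: sumr_ge0 => l _; rewrite -expr2 sqr_ge0. Qed.

Lemma enorm_sqr x : enorm x ^+ 2 = dot x x.
Proof. by rewrite sqr_sqrtr // dotxx_ge0. Qed.

Lemma enorm_le x y : (enorm x <= enorm y) = (dot x x <= dot y y).
Proof. by rewrite ler_sqrt // dotxx_ge0. Qed.

Lemma normr_le_enorm x : `|x| <= enorm x.
Proof.
rewrite [`|x|]/Num.norm /= mx_normrE; apply/bigmax_leP; split => [|[i l] _ /=].
  exact: sqrtr_ge0.
rewrite -sqrtr_sqr ler_sqrt ?dotxx_ge0 // ord1 /dot (bigD1 l) //= -expr2.
by rewrite lerDl; apply: sumr_ge0 => j _; rewrite -expr2 sqr_ge0.
Qed.

Lemma dotxx_eq0 x : (dot x x == 0) = (x == 0).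
Proof.
apply/eqP/eqP => [x0|->]; last by rewrite dot0r.
by apply/eqP; rewrite -normr_le0; have := normr_le_enorm x; rewrite /enorm x0 sqrtr0.
Qed.

Lemma dotxx_le0 x : dot x x <= 0 -> x = 0.
Proof. by move=> xle0; apply/eqP; rewrite -dotxx_eq0 eq_le xle0 dotxx_ge0. Qed.

Lemma cvg_dot {T : Type} {F : set_system T} {FF : Filter F}
    (f g : T -> 'rV[R]_n) x y :
  f @ F --> x -> g @ F --> y -> dot (f t) (g t) @[t --> F] --> dot x y.
Proof.
move=> fx gy; apply: cvg_big => [|l _]; first exact: add_continuous.
apply: cvgM.
  exact: (cvg_comp _ _ fx (@coord_continuous _ _ _ 0 l x)).
exact: (cvg_comp _ _ gy (@coord_continuous _ _ _ 0 l y)).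
Qed.

End Dot.

(** * Convergence along ultrafilters *)

Section Ultrafilters.
Context {R : realType} {n : nat}.

(** If some neighborhood of [l] is missed by [f] on a set that meets every
    member of [F], an ultrafilter finer than [F] contains that set. *)
Lemma cvg_ultra {T : Type} {V : topologicalType} {F : set_system T}
    {FF : ProperFilter F} (f : T -> V) (l : V) :
  (forall U : set_system T, UltraFilter U -> F `<=` U -> f @ U --> l) ->
  f @ F --> l.
Proof.
move=> fU N Nl; apply: contrapT => nFN.
have GF : ProperFilter (within (~` (f @^-1` N)) F).
  apply: Build_ProperFilter => nF; apply: nFN.
  rewrite /within /= in nF; change (F (f @^-1` N)).
  by apply: filterS nF => t nt; apply: contrapT => /nt.
have [U [UU FU]] := ultraFilterLemma GF.
have UN : U (f @^-1` N).
  by apply: (fU U) => // A FA; apply: FU; apply: filterS FA.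
have UnN : U (~` (f @^-1` N)) by apply: FU; apply: nearW.
have [t []] : (f @^-1` N `&` ~` (f @^-1` N)) !=set0.
  by apply: (@filter_ex _ U); exact: filterI.
by move=> fN /(_ fN).
Qed.

Section Compactness.
Context {T : Type} {U : set_system T} {UU : UltraFilter U}.

Lemma compact_ultra_cvg {V : topologicalType} (K : set V) (f : T -> V) :
  compact K -> (\forall t \near U, K (f t)) -> exists2 l, K l & f @ U --> l.
Proof.
move=> Kco fK.
have FU : UltraFilter (f @ U).
  split=> [|G GG fUG]; first exact: fmap_proper_filter.
  rewrite eqEsubset; split=> // A GA.
  have [//|UnA] := in_ultra_setVsetC (f @^-1` A) UU.
  have /(filterI GA) : G (~` A) by exact: fUG.
  by rewrite setICr => /filter_not_empty.
by move: Kco; rewrite compact_ultra => /(_ _ FU fK) [l [Kl fl]]; exists l.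
Qed.

Lemma bounded_ultra_cvg (f : T -> 'rV[R]_n) (M : R) :
  (\forall t \near U, `|f t| <= M) -> exists l : 'rV[R]_n, f @ U --> l.
Proof.
move=> fM; suff Kco : compact [set x : 'rV[R]_n | `|x| <= M].
  by have [l _ fl] := compact_ultra_cvg Kco fM; exists l.
apply: bounded_closed_compact.
  exists M; split; first exact: num_real.
  by move=> M' MM' x /= xM; rewrite (le_trans xM) // ltW.
apply: (@preimage_closed _ _ (fun x : 'rV[R]_n => `|x|) [set a | a <= M]).
  by move=> x _; exact: norm_continuous.
exact: closed_le.
Qed.

Lemma segment_ultra_cvg (f : T -> R) (a b : R) :
  (forall t, a <= f t <= b) -> exists2 l, a <= l <= b & f @ U --> l.
Proof.
move=> fab; have fK : \forall t \near U, `[a, b]%classic (f t).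
  by apply: nearW => t; rewrite /= in_itv /= fab.
have [l + fl] := compact_ultra_cvg (@segment_compact R a b) fK.
by rewrite /= in_itv /= => ?; exists l.
Qed.

End Compactness.
End Ultrafilters.

(** * Maximal monotone operators *)

Section Operators.
Context {R : realType} {n : nat}.
Implicit Types (x y u v w : 'rV[R]_n) (T : operator R n).

(** Adding the pair [(x, u)] to the graph keeps it monotone, so maximality says
    that the pair was already there. *)
Lemma maximal_monotone_graph T x u : maximal_monotone T ->
  (forall y v, T y v -> 0 <= dot (u - v) (x - y)) -> T x u.
Proof.
move=> [Tmono Tmax] xu.
pose T' : operator R n := fun z => T z `|` [set w | z = x /\ w = u].
apply: (Tmax T'); last by right.
- move=> y z v w [Tyv|[-> ->]] [Tzw|[-> ->]].
  + exact: Tmono Tyv Tzw.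
  + by rewrite -opprB dotNl -[y - x]opprB dotNr opprK xu.
  + exact: xu.
  + by rewrite !subrr dot0r.
- by move=> z w Tzw; left.
Qed.

Lemma maximal_monotone_cvg {I : Type} {F : set_system I} {FF : ProperFilter F}
    T (x_ u_ : I -> 'rV[R]_n) x u : maximal_monotone T ->
  (\forall t \near F, T (x_ t) (u_ t)) -> x_ @ F --> x -> u_ @ F --> u -> T x u.
Proof.
move=> Tmm Txu x_x u_u; apply: maximal_monotone_graph => // y v Tyv.
apply: (cvgr_to_ge (f := fun t => dot (u_ t - v) (x_ t - y)) (F := F)).
  by apply: cvg_dot; apply: cvgB => //; exact: cvg_cst.
by apply: filterS Txu => t Txu; exact: Tmm.1 Txu Tyv.
Qed.

(** If the values [f (y_ t)] are bounded, their limit is a value of the operator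
    at [x], hence [f x].  If they are not, the limit [w] of the normalized values
    is a unit vector with [<w, x - y> >= 0] for all [y] in [D]; then [f x + w] is
    another value at [x], which contradicts single-valuedness. *)
Lemma ptop_continuous {I : Type} {U : set_system I} {UU : UltraFilter U}
    (D : set 'rV[R]_n) (f : 'rV[R]_n -> 'rV[R]_n) (y_ : I -> 'rV[R]_n) x :
  maximal_monotone (ptop D f) -> (\forall t \near U, D (y_ t)) -> D x ->
  y_ @ U --> x -> f (y_ t) @[t --> U] --> f x.
Proof.
move=> fmm Dy Dx y_x.
have [[M fM]|unbounded] := pselect (exists M, \forall t \near U, `|f (y_ t)| <= M).
  have [l fl] := bounded_ultra_cvg fM.
  suff [_ <-] : ptop D f x l by [].
  apply: (maximal_monotone_cvg fmm _ y_x fl).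
  by apply: filterS Dy => t Dt.
have large M : \forall t \near U, M < `|f (y_ t)|.
  have [fM|] := in_ultra_setVsetC [set t | `|f (y_ t)| <= M] UU.
    by case: unbounded; exists M.
  by apply: filterS => t /negP; rewrite -ltNge.
pose w_ t := `|f (y_ t)|^-1 *: f (y_ t).
have norm_w : \forall t \near U, `|w_ t| = 1.
  apply: filterS (large 0) => t ft.
  by rewrite normrZ normfV normr_id mulVf // gt_eqF.
have [w w_w] : exists w : 'rV[R]_n, w_ @ U --> w.
  by apply: (@bounded_ultra_cvg _ _ _ _ _ _ 1); apply: filterS norm_w => t ->.
have inv0 : `|f (y_ t)|^-1 @[t --> U] --> (0 : R).
  apply/cvgr0Pnorm_le => e e0; apply: filterS (large e^-1) => t et.
  rewrite normfV normr_id -[leRHS]invrK lef_pV2 ?posrE ?invr_gt0 //; first exact: ltW.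
  by rewrite (lt_trans _ et) // invr_gt0.
have [_ fw] : ptop D f x (f x + w).
  apply: (maximal_monotone_graph fmm) => y v [Dyy ->].
  rewrite addrAC dotDl addr_ge0 //; first exact: fmm.1.
  (* [<w, x - y>] is the limit of the monotonicity inequality between [y_ t] and
     [y], divided by the norm of [f (y_ t)]. *)
  rewrite -[w]subr0 -(scale0r (f y)).
  apply: (cvgr_to_ge (F := U)
    (f := fun t => dot (w_ t - `|f (y_ t)|^-1 *: f y) (y_ t - y))).
    by apply: cvg_dot; apply: cvgB => //; [exact: cvgZr_tmp|exact: cvg_cst].
  apply: filterS Dy => t Dyt; rewrite -scalerBr dotZl mulr_ge0 ?invr_ge0 //.
  exact: fmm.1.
have w0 : w = 0 by apply: (addrI (f x)); rewrite fw addr0.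
have : `|w| = 1.
  apply: (cvg_unique _ (F := (fun t => `|w_ t|) @ U)); first exact: norm_hausdorff.
    exact: cvg_norm.
  apply: cvg_near_cst; exact: norm_w.
by rewrite w0 normr0 => /esym/eqP; rewrite oner_eq0.
Qed.

End Operators.

(** * Projections *)

Section Projection.
Context {R : realType} {n : nat}.
Implicit Types (x y p : 'rV[R]_n) (C : set 'rV[R]_n).

Lemma closed_halfspace (a c : 'rV[R]_n) (b : R) : closed [set y | dot (y - c) a <= b].
Proof.
apply: (@preimage_closed _ _ (fun y => dot (y - c) a) [set s | s <= b]).
  by move=> y _; exact: (cvg_dot (cvgB cvg_id (cvg_cst c)) (cvg_cst a)).
exact: closed_le.
Qed.

Lemma eproj_nearest C x : C !=set0 -> closed C ->
  C (eproj C x) /\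
  forall y, C y -> dot (x - eproj C x) (x - eproj C x) <= dot (x - y) (x - y).
Proof.
move=> [y0 Cy0] Ccl.
pose g y := dot (x - y) (x - y).
have gc (y : 'rV[R]_n) : g z @[z --> y] --> g y.
  have xy : x - z @[z --> y] --> x - y
    by apply: (@cvgB _ _ _ (nbhs y) _ (cst x) id); [exact: cvg_cst|exact: cvg_id].
  exact: (cvg_dot xy xy).
(* Only the points of [C] at least as close to [x] as [y0] compete, and they form
   a compact set. *)
pose K := C `&` [set y | g y <= g y0].
have Kco : compact K.
  apply: bounded_closed_compact.
    exists (`|x| + enorm (x - y0)); split; first exact: num_real.
    move=> M ltM y [_ gy]; apply: le_trans (ltW ltM).
    rewrite -[y](subKr x) (le_trans (ler_normB _ _)) // lerD2l.
    by rewrite (le_trans (normr_le_enorm _)) // enorm_le.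
  apply: closedI => //.
  apply: (@preimage_closed _ _ g [set s | s <= g y0]); last exact: closed_le.
  by move=> y _; exact: gc.
have [p /set_mem [Cp gp] pmin] : exists2 p, p \in K & forall y, y \in K -> g p <= g y.
  apply: EVT_min_rV => //; first by exists y0; split => //=.
  exact: continuous_subspaceT.
rewrite /eproj; case: xgetP => [_ -> [Cq qmin]|/(_ p)].
  by split=> // y Cy; rewrite -enorm_le qmin.
case; split=> // y Cy; rewrite enorm_le.
have [yy0|/ltW y0y] := leP (g y) (g y0); last exact: le_trans gp y0y.
by apply: pmin; exact/mem_set.
Qed.

(** First-order optimality of [p] along the segment from [p] to [y]. *)
Lemma nearest_variational C x p y :
  (forall z, C z -> dot (x - p) (x - p) <= dot (x - z) (x - z)) ->
  (forall t : R, 0 < t <= 1 -> C (t *: y + (1 - t) *: p)) ->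
  dot (y - p) (x - p) <= 0.
Proof.
move=> pmin seg; rewrite leNgt; apply/negP; set a := dot _ _ => a_gt0.
pose b := dot (y - p) (y - p).
have b_ge0 : 0 <= b by exact: dotxx_ge0.
have ab_gt0 : 0 < a + b by rewrite ltr_wpDr.
(* For this step length the gain [2 t a] exceeds the loss [t^2 b]. *)
pose t := a / (a + b).
have tE : t * (a + b) = a by rewrite divfK // gt_eqF.
have t_gt0 : 0 < t by rewrite divr_gt0.
have t_le1 : t <= 1 by rewrite ler_pdivrMr // mul1r lerDl.
have /pmin : C (t *: y + (1 - t) *: p) by apply: seg; rewrite t_gt0.
have -> : x - (t *: y + (1 - t) *: p) = (x - p) - t *: (y - p).
  by apply/rowP => l; rewrite !mxE; ring.
rewrite [leRHS]dotB_sqr !dotZl dotZr -/a -/b => le_b.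
have ta : 0 < t * a by rewrite mulr_gt0.
have tta : 0 < t * (t * a) by rewrite mulr_gt0.
have ttb : t * (t * b) = t * a - t * (t * a) by rewrite -[in X in X - _]tE; ring.
lra.
Qed.

End Projection.

Section Halfspaces.
Context {R : realType} {n : nat}.
Implicit Types (x y p : 'rV[R]_n) (C : set 'rV[R]_n).

Lemma segment_halfspace (a c : 'rV[R]_n) y p (t : R) :
  dot (y - c) a <= 0 -> dot (p - c) a <= 0 -> 0 < t <= 1 ->
  dot (t *: y + (1 - t) *: p - c) a <= 0.
Proof.
move=> ya pa /andP[t_gt0 t_le1].
have -> : t *: y + (1 - t) *: p - c = t *: (y - c) + (1 - t) *: (p - c).
  by apply/rowP => l; rewrite !mxE; ring.
by rewrite dotDl !dotZl; nra.
Qed.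

(** The angle at [x] between [x0] and [y] is at least a right angle. *)
Lemma Wplane_pythagoras x0 x y : Wplane x0 x y ->
  dot (x0 - x) (x0 - x) + dot (y - x) (y - x) <= dot (x0 - y) (x0 - y).
Proof.
rewrite /Wplane /= => yx; have -> : x0 - y = (x0 - x) - (y - x).
  by apply/rowP => l; rewrite !mxE; ring.
by rewrite [leRHS]dotB_sqr; lra.
Qed.

(** Pythagoras' inequality makes [x] strictly closer to [x0] than any other point
    of [C]. *)
Lemma eproj_unique C x0 x : C x -> C `<=` Wplane x0 x -> eproj C x0 = x.
Proof.
move=> Cx CW; rewrite /eproj; case: xgetP => [q _ [Cq qmin]|/(_ x)].
  have := qmin _ Cx; rewrite enorm_le => qx.
  apply/eqP; rewrite -subr_eq0; apply/eqP/dotxx_le0.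
  have := Wplane_pythagoras (CW _ Cq); lra.
case; split => // y Cy; rewrite enorm_le.
by apply: le_trans (Wplane_pythagoras (CW _ Cy)); rewrite lerDl dotxx_ge0.
Qed.

End Halfspaces.

(** * Forward-backward step *)

Section ForwardBackward.
Context {R : realType} {n : nat}.
Variables (D : set 'rV[R]_n) (f : 'rV[R]_n -> 'rV[R]_n) (T : operator R n).
Implicit Types (x y p : 'rV[R]_n).

Lemma zeros_add_ptop x : zeros (op_add (ptop D f) T) x <-> D x /\ T x (- f x).
Proof.
split=> [[v [Dx ->] [w Tw fw]]|[Dx Tx]].
  by split=> //; rewrite (addr0_eq fw).
by exists (f x); [|exists (- f x); rewrite ?subrr].
Qed.

(** The cutting half-spaces of the algorithm keep all the solutions: this is the
    monotonicity of [f + T] between [x] and [p], where [0] is a value at [p]. *)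
Lemma zeros_halfspace p x u : monotone_op (ptop D f) -> monotone_op T ->
  zeros (op_add (ptop D f) T) p -> D x -> T x u -> dot (f x + u) (p - x) <= 0.
Proof.
move=> fmono Tmono /zeros_add_ptop [Dp Tp] Dx Tx.
have fge : 0 <= dot (f x - f p) (x - p) by exact: fmono.
have := Tmono _ _ _ _ Tx Tp; rewrite opprK => Tge.
by rewrite -[p - x]opprB dotNr oppr_le0; move: fge Tge; rewrite !dotE; lra.
Qed.

Lemma resolvent_graph (b : R) z j : 0 < b -> resolvent b T z j ->
  T j (b^-1 *: (z - j)).
Proof.
move=> b_gt0 [_ -> [_ [v Tv <-] <-]].
by rewrite addrC addKr scalerA mulVf ?scale1r // gt_eqF.
Qed.

(** The hypothesis on [T j] says that [j] is the forward-backward step from [x].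
    Monotonicity of [T] between [x] and [j] gives
    [<f x + u, x - j> >= |x - j|^2 / b], so, as [delta < 1], the
    line search inequality can be reversed only when [x = j].  The inequality is
    not strict because it arises as a limit of failed tests. *)
Lemma forward_backward_unique (b delta : R) x j u :
  0 < b -> delta < 1 -> monotone_op T ->
  T j (b^-1 *: (x - b *: f x - j)) -> T x u ->
  dot (f x + u) (x - j) <= delta / b * dot (x - j) (x - j) -> x = j.
Proof.
move=> b_gt0 delta_lt1 Tmono Tj Tx.
have := Tmono _ _ _ _ Tx Tj.
have -> : u - b^-1 *: (x - b *: f x - j) = (f x + u) - b^-1 *: (x - j).
  by apply/rowP => l; rewrite !mxE; field; rewrite gt_eqF.
rewrite dotDl dotNl dotZl mulrC [delta / b]mulrC -mulrA => ge_b le_b.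
apply/eqP; rewrite -subr_eq0; apply/eqP/dotxx_le0.
have : (1 - delta) * (b^-1 * dot (x - j) (x - j)) <= 0 by lra.
by rewrite pmulr_rle0 ?subr_gt0 // pmulr_rle0 ?invr_gt0.
Qed.

(** The resolvent is nonexpansive and maps [y + b *: v] to [y]. *)
Lemma resolvent_bound (b : R) z j y v : 0 < b -> monotone_op T ->
  resolvent b T z j -> T y v -> `|j - y| <= enorm (z - y - b *: v).
Proof.
move=> b_gt0 Tmono /(resolvent_graph b_gt0) Tj Ty.
apply: le_trans (normr_le_enorm _) _; rewrite enorm_le.
set d := j - y; set e := z - y - b *: v.
have : 0 <= dot (e - d) d.
  have -> : e - d = b *: (b^-1 *: (z - j) - v).
    by apply/rowP => l; rewrite !mxE; field; rewrite gt_eqF.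
  by rewrite dotZl mulr_ge0 ?(ltW b_gt0) //; exact: Tmono Tj Ty.
have := dotxx_ge0 (e - d); rewrite dotB_sqr dotDl dotNl (dotC d e); lra.
Qed.

End ForwardBackward.

(** * Analysis of a run *)

Section Run.
Context {R : realType} {n m : nat}.
Variables (domA : 'I_m -> set 'rV[R]_n) (A : 'I_m -> 'rV[R]_n -> 'rV[R]_n).
Variables (B : 'I_m -> operator R n) (X : set 'rV[R]_n).
Variables (beta : nat -> R) (theta delta r : R).
Variables (xs : nat -> 'rV[R]_n) (J : nat -> 'I_m -> 'rV[R]_n).
Variables (u : nat -> nat -> 'I_m -> 'rV[R]_n) (ls : nat -> 'I_m -> nat).

Hypothesis maxA : forall i, maximal_monotone (ptop (domA i) (A i)).
Hypothesis maxB : forall i, maximal_monotone (B i).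
Hypothesis domBA : forall i, dom (B i) `<=` domA i.
Hypothesis X_dom : X `<=` \bigcap_(i : 'I_m) dom (B i).
Hypothesis X_closed : closed X.
Hypothesis X_convex : convex_set (X : set (convex_lmodType 'rV[R]_n)).
Hypothesis XS_neq0 : X `&` Sstar domA A B !=set0.
Hypothesis theta01 : 0 < theta < 1.
Hypothesis run : variantA3_run A B X beta theta delta r xs J u ls.

Local Notation H := (Hk A theta xs J u ls).
Local Notation W := (Wk xs).
Local Notation fixed := (fixed_indices xs J).
Local Notation trial := (trial theta xs J).
Local Notation xbar := (xbar theta xs J ls).
Local Notation ubar := (ubar u ls).

Local Notation C k := (X `&` H k `&` W k).

Lemma segment_X y p (t : R) : X y -> X p -> 0 < t <= 1 ->
  X (t *: y + (1 - t) *: p).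
Proof.
move=> Xy Xp /andP[t_gt0 t_le1].
by have := X_convex (Itv01 (ltW t_gt0) t_le1) (mem_set Xy) (mem_set Xp); rewrite inE.
Qed.

Lemma trial_dom k j i : ~ fixed k i -> (j <= ls k i)%N -> domA i (trial k j i).
Proof.
by move=> ki jl; apply: domBA; have [Bu _] := run_select run ki jl; exists (u k j i).
Qed.

Lemma solution_Hk k : X `&` Sstar domA A B `<=` H k.
Proof.
move=> p [_ Sp] i ki; apply: (zeros_halfspace (maxA i).1 (maxB i).1).
- exact: Sp.
- exact: trial_dom.
- by have [] := run_select run ki (leqnn _).
Qed.

Lemma closed_C k : closed (C k).
Proof.
apply: closedI; last exact: closed_halfspace.
apply: closedI => //; apply: closed_bigI => i _.
rewrite (_ : Hplane _ _ _ _ =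
  [set y | dot (y - xbar k i) (A i (xbar k i) + ubar k i) <= 0]); last first.
  by apply/funext => y; rewrite /Hplane /= dotC.
exact: closed_halfspace.
Qed.

Lemma segment_C k y p (t : R) : C k y -> C k p -> 0 < t <= 1 ->
  C k (t *: y + (1 - t) *: p).
Proof.
move=> [[Xy Hy] Wy] [[Xp Hp] Wp] t01; split; first split.
- exact: segment_X.
- move=> i ki; rewrite /Hplane /= dotC.
  by apply: segment_halfspace => //; rewrite dotC; [exact: Hy|exact: Hp].
- exact: segment_halfspace.
Qed.

Lemma xs_variational k : C k !=set0 ->
  C k (xs k.+1) /\ C k `<=` Wplane (xs 0%N) (xs k.+1).
Proof.
move=> Ck; rewrite (run_update run k).
have [Cp pmin] := eproj_nearest (xs 0%N) Ck (@closed_C k).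
split=> // y Cy; apply: (nearest_variational (C := C k)) => // t t01.
exact: segment_C.
Qed.

(** The solutions in one set make it nonempty, so that the next iterate is its
    nearest point to [xs 0] and the next [Wk] contains the whole set. *)
Lemma solution_C k : X `&` Sstar domA A B `<=` C k.
Proof.
elim: k => [|k IH] p XSp; (split; first by split; [case: XSp|exact: solution_Hk]).
  by rewrite /Wk /Wplane /= subrr dot0r.
apply: (xs_variational _).2; last exact: IH.
by exists p; exact: IH.
Qed.

Lemma xs_C k : C k (xs k.+1).
Proof.
by apply: (xs_variational _).1; have [p /solution_C Cp] := XS_neq0; exists p.
Qed.

Lemma xs_X k : X (xs k).
Proof. by case: k => [|k]; [exact: run_init run|have [[]] := xs_C k]. Qed.

Lemma xs_dist_le k p : X p -> Sstar domA A B p ->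
  dot (xs 0%N - xs k) (xs 0%N - xs k) <= dot (xs 0%N - p) (xs 0%N - p).
Proof.
move=> Xp Sp; have [_ Wp] := solution_C k (conj Xp Sp).
by apply: le_trans (Wplane_pythagoras Wp); rewrite lerDl dotxx_ge0.
Qed.

Lemma xs_bounded : exists M, forall k, `|xs k| <= M.
Proof.
have [p [Xp Sp]] := XS_neq0.
exists (`|xs 0%N| + enorm (xs 0%N - p)) => k.
rewrite -[xs k](subKr (xs 0%N)) (le_trans (ler_normB _ _)) // lerD2l.
by rewrite (le_trans (normr_le_enorm _)) // enorm_le xs_dist_le.
Qed.

(** The squared steps are bounded by the increments of the bounded nondecreasing
    sequence of squared distances to [xs 0]. *)
Lemma xs_step_cvg0 : (xs k - xs k.+1) @[k --> \oo] --> (0 : 'rV[R]_n).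
Proof.
pose a k := dot (xs 0%N - xs k) (xs 0%N - xs k).
have step k : dot (xs k.+1 - xs k) (xs k.+1 - xs k) <= a k.+1 - a k.
  by have [_ /Wplane_pythagoras] := xs_C k; rewrite /a; lra.
have a_cvg : cvgn a.
  apply: nondecreasing_is_cvgn.
    apply/nondecreasing_seqP => k.
    by have := dotxx_ge0 (xs k.+1 - xs k); have := step k; lra.
  have [p [Xp Sp]] := XS_neq0.
  by exists (dot (xs 0%N - p) (xs 0%N - p)) => _ [k _ <-]; exact: xs_dist_le.
have a_step : (a k.+1 - a k) @[k --> \oo] --> (0 : R).
  rewrite -(subrr (limn a)); apply: cvgB; last exact: a_cvg.
  by have := a_cvg; rewrite -(cvg_shiftS a).
apply/cvgr0Pnorm_le => e e_gt0.
have /cvgr0Pnorm_le /(_ (e ^+ 2)) := a_step.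
rewrite exprn_gt0 // => /(_ isT); apply: filterS => k ak.
rewrite distrC (le_trans (normr_le_enorm _)) // -(ger0_norm (ltW e_gt0)).
rewrite -sqrtr_sqr ler_sqrt ?exprn_ge0 ?(ltW e_gt0) //.
by apply: le_trans ak; apply: le_trans (step k) (ler_norm _).
Qed.

Hypothesis delta_gt0 : 0 < delta.
Hypothesis delta_lt1 : delta < 1.
Hypothesis beta_gt0 : forall k, 0 < beta k.

Section Cluster.
Context {U : set_system nat} {UU : UltraFilter U}.
Variables (x : 'rV[R]_n) (b : R).
Hypothesis U_infty : \oo `<=` U.
Hypothesis xs_x : xs @ U --> x.
Hypothesis beta_b : beta @ U --> b.
Hypothesis b_gt0 : 0 < b.
Variable i : 'I_m.

Lemma cluster_X : X x.
Proof. by apply: (closed_cvg _ X_closed _ _ xs_x); apply: nearW; exact: xs_X. Qed.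

Lemma A_xs_cvg : A i (xs k) @[k --> U] --> A i x.
Proof.
apply: (ptop_continuous (maxA i)) => //.
  by apply: nearW => k; apply: domBA; exact: X_dom (xs_X k) i I.
by apply: domBA; exact: X_dom cluster_X i I.
Qed.

(** The points [J k i] are bounded because [x] has an image under [B i], against
    which [resolvent_bound] compares them. *)
Lemma J_cvg : exists j, J ^~ i @ U --> j /\
  B i j (b^-1 *: (x - b *: A i x - j)).
Proof.
have z_cvg : (xs k - beta k *: A i (xs k)) @[k --> U] --> x - b *: A i x.
  by apply: cvgB => //; apply: cvgZ => //; exact: A_xs_cvg.
have [v Bv] : B i x !=set0 by exact: X_dom cluster_X i I.
have e_cvg : (xs k - beta k *: A i (xs k) - x - beta k *: v) @[k --> U] -->
    x - b *: A i x - x - b *: v.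
  apply: cvgB; last exact: cvgZr_tmp.
  by apply: cvgB => //; exact: cvg_cst.
have J_le k := resolvent_bound (beta_gt0 k) (maxB i).1 (run_resolvent run k i) Bv.
pose M := dot (x - b *: A i x - x - b *: v) (x - b *: A i x - x - b *: v) + 1.
have [j Jj] : exists j : 'rV[R]_n, J ^~ i @ U --> j.
  apply: (@bounded_ultra_cvg _ _ _ _ _ _ (Num.sqrt M + `|x|)).
  have : \forall k \near U,
      dot (xs k - beta k *: A i (xs k) - x - beta k *: v)
          (xs k - beta k *: A i (xs k) - x - beta k *: v) <= M.
    by apply: (cvgr_le _ (cvg_dot e_cvg e_cvg)); rewrite ltrDl.
  apply: filterS => k le_M.
  rewrite -[J k i](subrK x) (le_trans (ler_normD _ _)) // lerD2r.
  apply: le_trans (J_le k) _; rewrite /enorm ler_sqrt // /M.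
  by rewrite addr_ge0 // dotxx_ge0.
exists j; split=> //.
apply: (maximal_monotone_cvg (maxB i) (F := U) _ Jj) => //; last first.
  apply: cvgZ; first by apply: cvgV; rewrite ?gt_eqF //; exact: beta_b.
  exact: cvgB z_cvg Jj.
by apply: nearW => k; exact: resolvent_graph (run_resolvent run k i).
Qed.

Section Limits.
Variable j : 'rV[R]_n.
Hypothesis J_j : J ^~ i @ U --> j.
Hypothesis not_fixed : \forall k \near U, ~ fixed k i.

(** Used for the accepted trial points and for the last rejected ones.  The
    selections are bounded by [r], so the limit [y] has an image under [B i] by
    closedness of the graph; this puts [y] in the domain of [A i], where [A i]
    is continuous. *)
Lemma trial_cvg (l : nat -> nat) (a : R) :
  (forall k, (l k <= ls k i)%N) -> theta ^+ l k @[k --> U] --> a ->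
  let y := a *: j + (1 - a) *: x in
  trial k (l k) i @[k --> U] --> y /\
  exists2 w, B i y w &
    (A i (trial k (l k) i) + u k (l k) i) @[k --> U] --> A i y + w.
Proof.
move=> l_le l_a y.
have trial_y : trial k (l k) i @[k --> U] --> y.
  apply: cvgD; apply: cvgZ => //.
  by apply: cvgB => //; exact: cvg_cst.
have selected : \forall k \near U,
    (B i (trial k (l k) i) `&` eball 0 r) (u k (l k) i).
  by apply: filterS not_fixed => k ki; exact: (run_select run ki (l_le k)).
have [w w_w] : exists w : 'rV[R]_n, u k (l k) i @[k --> U] --> w.
  apply: (@bounded_ultra_cvg _ _ _ _ _ _ r); apply: filterS selected => k [_].
  by rewrite /eball /= subr0; apply: le_trans; exact: normr_le_enorm.
have Byw : B i y w.
  apply: (maximal_monotone_cvg (maxB i) _ trial_y w_w).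
  by apply: filterS selected => k [].
split=> //; exists w => //; apply: cvgD => //.
apply: (ptop_continuous (maxA i)) => //; last by apply: domBA; exists w.
by apply: filterS not_fixed => k ki; exact: trial_dom.
Qed.

(** The hyperplane through the accepted trial point separates [x^k] from
    [x^(k+1)].  The line search test measures how far [x^k] is on its side. *)
Lemma accepted_step k : ~ fixed k i ->
  theta ^+ ls k i * (delta / beta k * dot (xs k - J k i) (xs k - J k i)) <=
    dot (A i (xbar k i) + ubar k i) (xs k - xs k.+1).
Proof.
move=> ki; have := run_accept run ki.
rewrite /linesearch_test enorm_sqr => accept.
have [[_ /(_ i ki) +] _] := xs_C k; rewrite /Hplane /=.
rewrite -/(xbar k i) -/(ubar k i) in accept *.
set g := A i _ + _ => Hg.
have -> : xs k - xs k.+1 =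
    theta ^+ ls k i *: (xs k - J k i) - (xs k.+1 - xbar k i).
  by apply/rowP => c; rewrite /Defs.xbar /Defs.trial !mxE; ring.
rewrite [leRHS]dotDr dotNr dotZr; apply: ler_wpDr; first by rewrite oppr_ge0.
apply: ler_wpM2l => //; case/andP: theta01 => theta_gt0 _.
by rewrite exprn_ge0 ?ltW.
Qed.

Lemma cvg_D : (xs k - J k i) @[k --> U] --> x - j.
Proof. exact: cvgB. Qed.

Lemma test_cvg : delta / beta k * dot (xs k - J k i) (xs k - J k i) @[k --> U]
  --> delta / b * dot (x - j) (x - j).
Proof.
apply: cvgM; last exact: cvg_dot cvg_D cvg_D.
by apply: cvgM; [exact: cvg_cst|apply: cvgV => //; rewrite gt_eqF].
Qed.

(** Either the step lengths [alpha] have a positive limit, and [accepted_step]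
    concludes since the steps vanish, or they tend to [0] and the test failed at
    the previous trial points, whose limit is [x]. *)
Lemma J_limit : B i j (b^-1 *: (x - b *: A i x - j)) -> x = j.
Proof.
move=> Bj; have /andP[theta_gt0 theta_lt1] := theta01.
have alpha01 k : 0 <= theta ^+ ls k i <= 1.
  by rewrite exprn_ge0 ?exprn_ile1 // ltW.
have [a /andP[a_ge0 _] alpha_a] := segment_ultra_cvg (UU := UU) alpha01.
have [a0|a_neq0] := eqVneq a 0; last first.
  have [_ [w _ g_cvg]] := trial_cvg (fun k => leqnn _) alpha_a.
  have le0 : a * (delta / b * dot (x - j) (x - j)) <= 0.
    set y := a *: j + _ in g_cvg.
    rewrite -(dot0r (A i y + w)).
    apply: (ler_cvg_to (a := U) (cvgM alpha_a test_cvg)).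
      apply: cvg_dot g_cvg _; apply: cvg_trans xs_step_cvg0.
      exact: cvg_app.
    by apply: filterS not_fixed => k; exact: accepted_step.
  apply/eqP; rewrite -subr_eq0; apply/eqP/dotxx_le0.
  move: le0; rewrite pmulr_rle0 ?lt_def ?a_neq0 // pmulr_rle0 //.
  exact: divr_gt0.
(* A small [alpha = theta ^+ ls] means that at least one trial was rejected. *)
have ls_gt0 : \forall k \near U, (0 < ls k i)%N.
  have : \forall k \near U, theta ^+ ls k i < 1.
    by apply: (cvgr_lt _ alpha_a); rewrite a0.
  by apply: filterS => k; case: (ls k i) => //; rewrite expr0 ltxx.
have prev_0 : theta ^+ (ls k i).-1 @[k --> U] --> (0 : R).
  have : theta^-1 * theta ^+ ls k i @[k --> U] --> (0 : R).
    by rewrite -(mulr0 theta^-1) -a0; apply: cvgM => //; exact: cvg_cst.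
  apply: cvg_trans; apply: near_eq_cvg; apply: filterS ls_gt0 => k.
  by case: (ls k i) => // l _; rewrite exprS mulKf // gt_eqF.
have [_] := trial_cvg (fun k => leq_pred _) prev_0.
rewrite scale0r add0r subr0 scale1r => -[w Bw g_cvg].
apply: (forward_backward_unique b_gt0 delta_lt1 (maxB i).1 Bj Bw).
apply: (ler_cvg_to (a := U) (cvg_dot g_cvg cvg_D) test_cvg).
apply: filterS2 not_fixed ls_gt0 => k ki lk.
have /(run_reject run ki) : ((ls k i).-1 < ls k i)%N by rewrite prednK.
by rewrite /linesearch_test enorm_sqr => /negP; rewrite -ltNge => /ltW.
Qed.

End Limits.

Lemma cluster_zero : zeros (op_add (ptop (domA i) (A i)) (B i)) x.
Proof.
have [j [J_j Bj]] := J_cvg.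
suff xj : x = j.
  apply/zeros_add_ptop; split; first by apply: domBA; exact: X_dom cluster_X i I.
  move: Bj; rewrite -xj addrAC subrr sub0r scalerN scalerA mulVf ?scale1r //.
  by rewrite gt_eqF.
have [fixedU|not_fixed] := in_ultra_setVsetC [set k | fixed k i] UU; last first.
  exact: J_limit J_j not_fixed Bj.
apply: (cvg_unique _ xs_x); first exact: norm_hausdorff.
apply: cvg_trans J_j; apply: near_eq_cvg.
by apply: filterS fixedU => k ->.
Qed.

End Cluster.
End Run.

(** * Convergence of the iterates *)

Theorem theorem4p18 (R : realType) (n m : nat)
  (domA : 'I_m -> set 'rV[R]_n) (A : 'I_m -> 'rV[R]_n -> 'rV[R]_n)
  (B : 'I_m -> operator R n) (X : set 'rV[R]_n)
  (beta : nat -> R) (betalo betahi theta delta r : R)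
  (xs : nat -> 'rV[R]_n) (J : nat -> 'I_m -> 'rV[R]_n)
  (u : nat -> nat -> 'I_m -> 'rV[R]_n) (ls : nat -> 'I_m -> nat)
  (maxA : forall i, maximal_monotone (ptop (domA i) (A i)))
  (maxB : forall i, maximal_monotone (B i))
  (domBA : forall i, dom (B i) `<=` domA i)
  (X_dom : X `<=` \bigcap_(i : 'I_m) dom (B i))
  (X_neq0 : X !=set0) (X_closed : closed X)
  (X_convex : convex_set (X : set (convex_lmodType 'rV[R]_n)))
  (XS_neq0 : X `&` Sstar domA A B !=set0)
  (B_sel : bounded_selection_assumption B)
  (betalo_gt0 : 0 < betalo) (betalohi : betalo <= betahi)
  (beta_in : forall k, betalo <= beta k <= betahi)
  (theta01 : 0 < theta < 1) (delta01 : 0 < delta < 1)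
  (r_provided : radius_provided B theta r xs J ls)
  (run : variantA3_run A B X beta theta delta r xs J u ls)
  (nostop : never_stops xs J) :
  xs k @[k --> \oo] --> eproj (Sstar domA A B `&` X) (xs 0%N).
Proof.
have /andP[theta_gt0 theta_lt1] := theta01.
have /andP[delta_gt0 delta_lt1] := delta01.
have beta_gt0 k : 0 < beta k.
  by have /andP[+ _] := beta_in k; exact: lt_le_trans.
apply: cvg_ultra => U UU U_infty.
have [M xsM] := xs_bounded maxA maxB domBA X_closed X_convex XS_neq0 run.
have [x xs_x] : exists x : 'rV[R]_n, xs @ U --> x.
  by apply: (@bounded_ultra_cvg _ _ _ _ _ _ M); exact: nearW.
have [b /andP[b_ge _] beta_b] := segment_ultra_cvg (UU := UU) beta_in.
have b_gt0 : 0 < b by exact: lt_le_trans b_ge.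
suff -> : eproj (Sstar domA A B `&` X) (xs 0%N) = x by [].
apply: eproj_unique.
  split; last exact: (cluster_X maxA maxB domBA X_closed X_convex XS_neq0 run xs_x).
  move=> i _; exact: (cluster_zero maxA maxB domBA X_dom X_closed X_convex XS_neq0
    theta01 run delta_gt0 delta_lt1 beta_gt0 U_infty xs_x beta_b b_gt0).
move=> p [Sp Xp].
apply: (cvgr_to_le (F := U) (f := fun k => dot (p - xs k) (xs 0%N - xs k))).
  by apply: cvg_dot; apply: cvgB => //; exact: cvg_cst.
apply: nearW => k.
by have [_] := solution_C maxA maxB domBA X_closed X_convex run k (conj Xp Sp).
Qed.
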